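(* Let $(\mathcal C,\otimes,I,\gamma)$ be a symmetric monoidal category and $(\mathcal T,\eta,\mu,\tau)$ a strong monad on it that is centralisable, and for each object $X$ let $(\mathcal ZX,\iota_X)$ be a terminal central cone of $\mathcal T$ at $X$. Then the assignment $X\mapsto\mathcal ZX$ extends to a commutative monad $(\mathcal Z,\eta^{\mathcal Z},\mu^{\mathcal Z},\tau^{\mathcal Z})$ on $\mathcal C$. Moreover, $\mathcal Z$ is a commutative submonad of $\mathcal T$, and the morphisms $\iota_X:\mathcal ZX\to\mathcal TX$ constitute a monomorphism of strong monads $\iota:\mathcal Z\Rightarrow\mathcal T$.
   Context: Left strength $\tau_{X,Y}:X\otimes\mathcal TY\to\mathcal T(X\otimes Y)$; right strength $\tau'_{X,Y}=\mathcal T(\gamma_{Y,X})\circ\tau_{Y,X}\circ\gamma_{\mathcal TX,Y}$. A strong monad is commutative if $\mu\circ\mathcal T\tau'\circ\tau=\mu\circ\mathcal T\tau\circ\tau':\mathcal TX\otimes\mathcal TY\to\mathcal T(X\otimes Y)$ for all $X,Y$. A central cone of $\mathcal T$ at $X$ is a pair $(Z,\iota)$, $\iota:Z\to\mathcal TX$, such that for every object $Y$, $\mu\circ\mathcal T\tau'_{X,Y}\circ\tau_{\mathcal TX,Y}\circ(\iota\otimes\mathcal TY)=\mu\circ\mathcal T\tau_{X,Y}\circ\tau'_{X,\mathcal TY}\circ(\iota\otimes\mathcal TY):Z\otimes\mathcal TY\to\mathcal T(X\otimes Y)$. A morphism of central cones $(Z',\iota')\to(Z,\iota)$ is $\varphi:Z'\to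 Z$ with $\iota\circ\varphi=\iota'$; a terminal central cone at $X$ is a terminal object in this category. $\mathcal T$ is centralisable if a terminal central cone exists at every object. A morphism of strong monads $\iota:\mathcal S\Rightarrow\mathcal T$ is a natural transformation with $\iota\circ\eta^{\mathcal S}=\eta^{\mathcal T}$, $\iota\circ\mu^{\mathcal S}=\mu^{\mathcal T}\circ\mathcal T\iota\circ\iota_{\mathcal S}$, $\iota\circ\tau^{\mathcal S}_{X,Y}=\tau^{\mathcal T}_{X,Y}\circ(X\otimes\iota_Y)$; a (commutative) submonad of $\mathcal T$ is a (commutative) strong monad $\mathcal S$ with such an $\iota$ that is a monomorphism in the category of strong monads on $\mathcal C$. *)

(* Defs.v *)
From Stdlib Require Import FunctionalExtensionality ProofIrrelevance.

Set Implicit Arguments.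
Unset Strict Implicit.
Unset Printing Implicit Defensive.

Declare Scope cat_scope.
Delimit Scope cat_scope with cat.

Record category : Type := Category {
  obj :> Type;
  hom : obj -> obj -> Type;
  idm : forall X : obj, hom X X;
  comp : forall X Y Z : obj, hom Y Z -> hom X Y -> hom X Z;
  comp_idl : forall (X Y : obj) (f : hom X Y), comp (idm Y) f = f;
  comp_idr : forall (X Y : obj) (f : hom X Y), comp f (idm X) = f;
  comp_assoc : forall (X Y Z W : obj) (h : hom Z W) (g : hom Y Z) (f : hom X Y),
    comp h (comp g f) = comp (comp h g) f
}.

Arguments hom {_} _ _.
Arguments idm {_} _.
Arguments comp {_ _ _ _} _ _.

Notation "g ∘ f" := (comp g f) (at level 40, left associativity) : cat_scope.
Open Scope cat_scope.

Definition mutually_inverse (C : category) (X Y : C)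
    (f : hom X Y) (g : hom Y X) : Prop :=
  g ∘ f = idm X /\ f ∘ g = idm Y.

Definition monic (C : category) (X Y : C) (m : hom X Y) : Prop :=
  forall (W : C) (f g : hom W X), m ∘ f = m ∘ g -> f = g.

Definition terminal (C : category) (X : C) : Prop :=
  forall Y : C, exists! f : hom Y X, True.

Record symmetric_monoidal_category : Type := SymmetricMonoidalCategory {
  smc_cat :> category;
  tens : smc_cat -> smc_cat -> smc_cat;
  tensm : forall X X' Y Y' : smc_cat,
    hom X X' -> hom Y Y' -> hom (tens X Y) (tens X' Y');
  unit : smc_cat;
  assoc : forall X Y Z : smc_cat, hom (tens (tens X Y) Z) (tens X (tens Y Z));
  assoc_inv : forall X Y Z : smc_cat, hom (tens X (tens Y Z)) (tens (tens X Y) Z);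
  lunit : forall X : smc_cat, hom (tens unit X) X;
  lunit_inv : forall X : smc_cat, hom X (tens unit X);
  runit : forall X : smc_cat, hom (tens X unit) X;
  runit_inv : forall X : smc_cat, hom X (tens X unit);
  braid : forall X Y : smc_cat, hom (tens X Y) (tens Y X);

  tensm_id : forall X Y : smc_cat, tensm (idm X) (idm Y) = idm (tens X Y);
  tensm_comp : forall (X X' X'' Y Y' Y'' : smc_cat)
      (f' : hom X' X'') (f : hom X X') (g' : hom Y' Y'') (g : hom Y Y'),
    tensm (f' ∘ f) (g' ∘ g) = tensm f' g' ∘ tensm f g;

  assoc_iso : forall X Y Z : smc_cat,
    mutually_inverse (assoc X Y Z) (assoc_inv X Y Z);
  lunit_iso : forall X : smc_cat, mutually_inverse (lunit X) (lunit_inv X);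
  runit_iso : forall X : smc_cat, mutually_inverse (runit X) (runit_inv X);

  assoc_nat : forall (X X' Y Y' Z Z' : smc_cat)
      (f : hom X X') (g : hom Y Y') (h : hom Z Z'),
    assoc X' Y' Z' ∘ tensm (tensm f g) h = tensm f (tensm g h) ∘ assoc X Y Z;
  lunit_nat : forall (X X' : smc_cat) (f : hom X X'),
    lunit X' ∘ tensm (idm unit) f = f ∘ lunit X;
  runit_nat : forall (X X' : smc_cat) (f : hom X X'),
    runit X' ∘ tensm f (idm unit) = f ∘ runit X;
  braid_nat : forall (X X' Y Y' : smc_cat) (f : hom X X') (g : hom Y Y'),
    braid X' Y' ∘ tensm f g = tensm g f ∘ braid X Y;

  pentagon : forall X Y Z W : smc_cat,
    assoc X Y (tens Z W) ∘ assoc (tens X Y) Z W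
    = tensm (idm X) (assoc Y Z W) ∘ assoc X (tens Y Z) W
      ∘ tensm (assoc X Y Z) (idm W);
  triangle : forall X Y : smc_cat,
    tensm (idm X) (lunit Y) ∘ assoc X unit Y = tensm (runit X) (idm Y);
  hexagon : forall X Y Z : smc_cat,
    assoc Y Z X ∘ braid X (tens Y Z) ∘ assoc X Y Z
    = tensm (idm Y) (braid X Z) ∘ assoc Y X Z ∘ tensm (braid X Y) (idm Z);
  braid_sym : forall X Y : smc_cat, braid Y X ∘ braid X Y = idm (tens X Y)
}.

Arguments tens {_} _ _.
Arguments tensm {_ _ _ _ _} _ _.
Arguments unit {_}.
Arguments assoc {_} _ _ _.
Arguments assoc_inv {_} _ _ _.
Arguments lunit {_} _.
Arguments lunit_inv {_} _.
Arguments runit {_} _.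
Arguments runit_inv {_} _.
Arguments braid {_} _ _.

Notation "X ⊗ Y" := (tens X Y) (at level 35, right associativity) : cat_scope.
Notation "f ⊗m g" := (tensm f g) (at level 35, right associativity) : cat_scope.

(* The object map is a parameter, so that "X |-> Z X extends to a strong monad"
   can be stated without transporting along equalities of objects. *)
Record strong_monad_on (C : symmetric_monoidal_category) (T : C -> C) : Type :=
    StrongMonadOn {
  fmap : forall X Y : C, hom X Y -> hom (T X) (T Y);
  eta : forall X : C, hom X (T X);
  mu : forall X : C, hom (T (T X)) (T X);
  tau : forall X Y : C, hom (X ⊗ T Y) (T (X ⊗ Y));

  fmap_id : forall X : C, fmap (idm X) = idm (T X);
  fmap_comp : forall (X Y Z : C) (g : hom Y Z) (f : hom X Y),
    fmap (g ∘ f) = fmap g ∘ fmap f;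

  eta_nat : forall (X Y : C) (f : hom X Y), eta Y ∘ f = fmap f ∘ eta X;
  mu_nat : forall (X Y : C) (f : hom X Y),
    mu Y ∘ fmap (fmap f) = fmap f ∘ mu X;
  tau_nat : forall (X X' Y Y' : C) (f : hom X X') (g : hom Y Y'),
    tau X' Y' ∘ (f ⊗m fmap g) = fmap (f ⊗m g) ∘ tau X Y;

  mu_eta : forall X : C, mu X ∘ eta (T X) = idm (T X);
  mu_fmap_eta : forall X : C, mu X ∘ fmap (eta X) = idm (T X);
  mu_mu : forall X : C, mu X ∘ mu (T X) = mu X ∘ fmap (mu X);

  tau_lunit : forall X : C, fmap (lunit X) ∘ tau unit X = lunit (T X);
  tau_assoc : forall X Y Z : C,
    fmap (assoc X Y Z) ∘ tau (X ⊗ Y) Z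
    = tau X (Y ⊗ Z) ∘ (idm X ⊗m tau Y Z) ∘ assoc X Y (T Z);
  tau_eta : forall X Y : C, tau X Y ∘ (idm X ⊗m eta Y) = eta (X ⊗ Y);
  tau_mu : forall X Y : C,
    tau X Y ∘ (idm X ⊗m mu Y) = mu (X ⊗ Y) ∘ fmap (tau X Y) ∘ tau X (T Y)
}.

Arguments fmap {_ _} _ {_ _} _.
Arguments eta {_ _} _ _.
Arguments mu {_ _} _ _.
Arguments tau {_ _} _ _ _.

Record strong_monad (C : symmetric_monoidal_category) : Type := StrongMonad {
  mobj :> C -> C;
  mstr :> strong_monad_on mobj
}.

Section Strengths.

Variables (C : symmetric_monoidal_category) (T : strong_monad C).

Definition rtau (X Y : C) : hom (T X ⊗ Y) (T (X ⊗ Y)) :=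
  fmap T (braid Y X) ∘ tau T Y X ∘ braid (T X) Y.

Definition dst_tau_first (X Y : C) : hom (T X ⊗ T Y) (T (X ⊗ Y)) :=
  mu T (X ⊗ Y) ∘ fmap T (rtau X Y) ∘ tau T (T X) Y.

Definition dst_rtau_first (X Y : C) : hom (T X ⊗ T Y) (T (X ⊗ Y)) :=
  mu T (X ⊗ Y) ∘ fmap T (tau T X Y) ∘ rtau X (T Y).

Definition commutative : Prop :=
  forall X Y : C, dst_tau_first X Y = dst_rtau_first X Y.

Record central_cone (X : C) : Type := CentralCone {
  apex : C;
  leg : hom apex (T X);
  leg_central : forall Y : C,
    dst_tau_first X Y ∘ (leg ⊗m idm (T Y))
    = dst_rtau_first X Y ∘ (leg ⊗m idm (T Y))
}.

Record cone_morphism (X : C) (c' c : central_cone X) : Type := ConeMorphism {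
  cone_map : hom (apex c') (apex c);
  cone_map_leg : leg c ∘ cone_map = leg c'
}.

End Strengths.

Lemma cone_morphism_eq (C : symmetric_monoidal_category) (T : strong_monad C)
    (X : C) (c' c : central_cone T X) (f g : cone_morphism c' c) :
  cone_map f = cone_map g -> f = g.
Proof.
destruct f as [f Hf], g as [g Hg]; simpl; intros ->.
f_equal; apply proof_irrelevance.
Qed.

Definition cone_idm (C : symmetric_monoidal_category) (T : strong_monad C)
    (X : C) (c : central_cone T X) : cone_morphism c c :=
  ConeMorphism (comp_idr (leg c)).

Lemma cone_comp_leg (C : symmetric_monoidal_category) (T : strong_monad C)
    (X : C) (a b c : central_cone T X)
    (g : cone_morphism b c) (f : cone_morphism a b) :
  leg c ∘ (cone_map g ∘ cone_map f) = leg a.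
Proof. now rewrite comp_assoc, !cone_map_leg. Qed.

Definition cone_comp (C : symmetric_monoidal_category) (T : strong_monad C)
    (X : C) (a b c : central_cone T X)
    (g : cone_morphism b c) (f : cone_morphism a b) : cone_morphism a c :=
  ConeMorphism (cone_comp_leg g f).

Definition central_cones (C : symmetric_monoidal_category) (T : strong_monad C)
    (X : C) : category.
Proof.
refine (@Category (central_cone T X) (@cone_morphism C T X)
          (@cone_idm C T X) (@cone_comp C T X) _ _ _);
  intros; apply cone_morphism_eq; simpl.
- apply comp_idl.
- apply comp_idr.
- apply comp_assoc.
Defined.

Definition centralisable (C : symmetric_monoidal_category) (T : strong_monad C) :
    Prop :=
  forall X : C, exists c : central_cones T X, terminal c.

Record strong_monad_morphism (C : symmetric_monoidal_category)
    (S T : strong_monad C) : Type := StrongMonadMorphism {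
  smm :> forall X : C, hom (S X) (T X);
  smm_nat : forall (X Y : C) (f : hom X Y),
    smm Y ∘ fmap S f = fmap T f ∘ smm X;
  smm_eta : forall X : C, smm X ∘ eta S X = eta T X;
  smm_mu : forall X : C,
    smm X ∘ mu S X = mu T X ∘ fmap T (smm X) ∘ smm (S X);
  smm_tau : forall X Y : C,
    smm (X ⊗ Y) ∘ tau S X Y = tau T X Y ∘ (idm X ⊗m smm Y)
}.

Lemma strong_monad_morphism_eq (C : symmetric_monoidal_category)
    (S T : strong_monad C) (f g : strong_monad_morphism S T) :
  (forall X : C, f X = g X) -> f = g.
Proof.
intros H.
assert (E : smm f = smm g) by (apply functional_extensionality_dep; exact H).
clear H; destruct f as [f f1 f2 f3 f4], g as [g g1 g2 g3 g4]; simpl in E.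
subst g; f_equal; apply proof_irrelevance.
Qed.

Definition smm_idm (C : symmetric_monoidal_category) (T : strong_monad C) :
    strong_monad_morphism T T.
Proof.
refine (@StrongMonadMorphism C T T (fun X => idm (T X)) _ _ _ _); intros.
- now rewrite comp_idl, comp_idr.
- apply comp_idl.
- now rewrite fmap_id, comp_idl, !comp_idr.
- now rewrite tensm_id, comp_idl, comp_idr.
Defined.

Definition smm_comp (C : symmetric_monoidal_category) (R S T : strong_monad C)
    (g : strong_monad_morphism S T) (f : strong_monad_morphism R S) :
    strong_monad_morphism R T.
Proof.
refine (@StrongMonadMorphism C R T (fun X => g X ∘ f X) _ _ _ _); intros.
- now rewrite <- comp_assoc, smm_nat, comp_assoc, smm_nat, comp_assoc.
- now rewrite <- comp_assoc, !smm_eta.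
- rewrite <- comp_assoc, smm_mu, !comp_assoc, smm_mu, fmap_comp.
  rewrite <- !comp_assoc; do 2 f_equal.
  now rewrite !comp_assoc, smm_nat.
- rewrite <- comp_assoc, smm_tau, comp_assoc, smm_tau, <- comp_assoc.
  now rewrite <- tensm_comp, comp_idl.
Defined.

Definition strong_monads (C : symmetric_monoidal_category) : category.
Proof.
refine (@Category (strong_monad C) (@strong_monad_morphism C)
          (@smm_idm C) (@smm_comp C) _ _ _);
  intros; apply strong_monad_morphism_eq; intros; simpl.
- apply comp_idl.
- apply comp_idr.
- apply comp_assoc.
Defined.

Definition is_commutative_submonad (C : symmetric_monoidal_category)
    (S T : strong_monads C) (i : hom S T) : Prop :=
  commutative S /\ monic i.

(* Main.v *)
From Stdlib Require Import IndefiniteDescription.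
Require Import Defs.

(** A morphism into [T X] is called central when it is the leg of a central
    cone at [X].  Central morphisms contain the unit and are closed under
    precomposition, under [fmap T], under Kleisli composition and under the
    strength, so the structure of [T] restricted along the legs factors through
    the terminal central cones.  The legs are monic by the uniqueness part of
    terminality; hence all the equations required of [Z] follow from those of
    [T], and commutativity of [Z] is the centrality of the legs. *)

Set Implicit Arguments.
Unset Strict Implicit.
Unset Printing Implicit Defensive.

(** * Rewriting composites modulo associativity *)

Section Reassociation.

Variable C : category.

Lemma comp2_precomp (W X Y Z : C) (f : hom Y Z) (g : hom X Y) (r : hom X Z)
    (k : hom W X) :
  f ∘ g = r -> f ∘ (g ∘ k) = r ∘ k.
Proof. now intros <-; rewrite comp_assoc. Qed.

Lemma comp3_precomp (W X Y Y' Z : C) (f : hom Y Z) (g : hom Y' Y)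
    (h : hom X Y') (r : hom X Z) (k : hom W X) :
  f ∘ (g ∘ h) = r -> f ∘ (g ∘ (h ∘ k)) = r ∘ k.
Proof. now intros <-; rewrite !comp_assoc. Qed.

End Reassociation.

(* Rewriting modulo associativity: composites are kept right-associated, and
   the left-hand side of [H] may be followed by further factors. *)
Ltac crewrite H :=
  let E := fresh "E" in
  pose proof H as E; rewrite <- ?comp_assoc in E; rewrite <- ?comp_assoc;
  first [ rewrite E | rewrite (comp2_precomp _ E) | rewrite (comp3_precomp _ E) ];
  clear E; rewrite <- ?comp_assoc.

(** * Whiskering by an identity, and a rearranged hexagon *)

Section Tensor.

Variable C : symmetric_monoidal_category.

Lemma tensm_compl (X X' X'' Y : C) (f' : hom X' X'') (f : hom X X') :
  (f' ∘ f) ⊗m idm Y = (f' ⊗m idm Y) ∘ (f ⊗m idm Y).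
Proof. now rewrite <- tensm_comp, comp_idl. Qed.

Lemma tensm_compr (X Y Y' Y'' : C) (g' : hom Y' Y'') (g : hom Y Y') :
  idm X ⊗m (g' ∘ g) = (idm X ⊗m g') ∘ (idm X ⊗m g).
Proof. now rewrite <- tensm_comp, comp_idl. Qed.

(* The hexagon with [braid X Z] moved to the other side. *)
Lemma hexagon_braid_inv (X Y Z : C) :
  assoc Y X Z ∘ (braid X Y ⊗m idm Z) ∘ assoc_inv X Y Z ∘ braid (Y ⊗ Z) X
  = (idm Y ⊗m braid Z X) ∘ assoc Y Z X.
Proof.
rewrite <- (comp_idl (assoc Y X Z)), <- tensm_id, <- (braid_sym X Z), tensm_compr.
crewrite (eq_sym (hexagon X Y Z)).
crewrite (proj2 (assoc_iso X Y Z)); rewrite comp_idl.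
now rewrite braid_sym, comp_idr.
Qed.

End Tensor.

(** * Left and right strength, and their compatibility *)

Section Strength.

Variables (C : symmetric_monoidal_category) (T : strong_monad C).

(** [fmap T] of [assoc_inv] is a left inverse. In [central_tau] this allows centrality to be tested
    after reassociating. *)
Lemma fmap_assoc_mono (X Y Z : C) : monic (fmap T (assoc X Y Z)).
Proof.
intros W f g E.
rewrite <- (comp_idl f), <- (comp_idl g), <- (fmap_id T).
rewrite <- (proj1 (assoc_iso X Y Z)), fmap_comp.
now rewrite <- !comp_assoc, E.
Qed.

Lemma tau_natl (X X' Y : C) (f : hom X X') :
  tau T X' Y ∘ (f ⊗m idm (T Y)) = fmap T (f ⊗m idm Y) ∘ tau T X Y.
Proof. now rewrite <- tau_nat, fmap_id. Qed.

Lemma rtau_nat (X X' Y Y' : C) (f : hom X X') (g : hom Y Y') :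
  rtau T X' Y' ∘ (fmap T f ⊗m g) = fmap T (f ⊗m g) ∘ rtau T X Y.
Proof.
unfold rtau.
crewrite (braid_nat (fmap T f) g).
crewrite (tau_nat T g f).
crewrite (eq_sym (fmap_comp T (braid Y' X') (g ⊗m f))).
rewrite braid_nat, fmap_comp; now rewrite <- !comp_assoc.
Qed.

Lemma rtau_natr (X Y Y' : C) (g : hom Y Y') :
  rtau T X Y' ∘ (idm (T X) ⊗m g) = fmap T (idm X ⊗m g) ∘ rtau T X Y.
Proof. now rewrite <- rtau_nat, fmap_id. Qed.

Lemma rtau_eta (X Y : C) : rtau T X Y ∘ (eta T X ⊗m idm Y) = eta T (X ⊗ Y).
Proof.
unfold rtau.
crewrite (braid_nat (eta T X) (idm Y)).
crewrite (tau_eta T Y X).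
crewrite (eq_sym (eta_nat T (braid Y X))).
now rewrite braid_sym, comp_idr.
Qed.

Lemma rtau_mu (X Y : C) :
  rtau T X Y ∘ (mu T X ⊗m idm Y)
  = mu T (X ⊗ Y) ∘ fmap T (rtau T X Y) ∘ rtau T (T X) Y.
Proof.
unfold rtau.
crewrite (braid_nat (mu T X) (idm Y)).
crewrite (tau_mu T Y X).
crewrite (eq_sym (mu_nat T (braid Y X))).
rewrite !fmap_comp.
(* The braidings between the two consecutive right strengths cancel. *)
crewrite (eq_sym (fmap_comp T (braid (T X) Y) (braid Y (T X)))).
now rewrite braid_sym, fmap_id, comp_idl.
Qed.

(** The bistrength law. With [rtau] written as a braided [tau], it follows from [tau_assoc] at
    [X, W, Y] and at [W, X, Y], linked by the hexagon. *)
Lemma tau_rtau_assoc (X Y W : C) :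
  fmap T (assoc X Y W) ∘ rtau T (X ⊗ Y) W ∘ (tau T X Y ⊗m idm W)
  = tau T X (Y ⊗ W) ∘ (idm X ⊗m rtau T Y W) ∘ assoc X (T Y) W.
Proof.
unfold rtau; rewrite !tensm_compr.
crewrite (tau_nat T (idm X) (braid W Y)).
(* The hexagon is used twice: here outside [fmap T], at [T Y], and later under [fmap T], at [Y]. *)
rewrite <- hexagon_braid_inv.
crewrite (eq_sym (tau_assoc T X W Y)).
crewrite (tau_natl Y (braid W X)).
crewrite (eq_sym (fmap_comp T (assoc X W Y) (braid W X ⊗m idm Y))).
crewrite (eq_sym (fmap_comp T (idm X ⊗m braid W Y)
                     (assoc X W Y ∘ (braid W X ⊗m idm Y)))).
rewrite (comp_assoc (idm X ⊗m braid W Y)), <- hexagon, !fmap_comp.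
crewrite (tau_assoc T W X Y).
crewrite (proj2 (assoc_iso W X (T Y))); rewrite comp_idl.
now rewrite braid_nat.
Qed.

(** * The two double strengths against [fmap], [eta], [mu] and [tau] *)

Lemma dst_tau_first_natl (X X' Y : C) (f : hom X X') :
  dst_tau_first T X' Y ∘ (fmap T f ⊗m idm (T Y))
  = fmap T (f ⊗m idm Y) ∘ dst_tau_first T X Y.
Proof.
unfold dst_tau_first.
crewrite (tau_natl Y (fmap T f)).
crewrite (eq_sym (fmap_comp T (rtau T X' Y) (fmap T f ⊗m idm Y))).
rewrite rtau_nat, fmap_comp.
crewrite (mu_nat T (f ⊗m idm Y)).
reflexivity.
Qed.

Lemma dst_rtau_first_natl (X X' Y : C) (f : hom X X') :
  dst_rtau_first T X' Y ∘ (fmap T f ⊗m idm (T Y))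
  = fmap T (f ⊗m idm Y) ∘ dst_rtau_first T X Y.
Proof.
unfold dst_rtau_first.
crewrite (rtau_nat f (idm (T Y))).
crewrite (eq_sym (fmap_comp T (tau T X' Y) (f ⊗m idm (T Y)))).
rewrite tau_natl, fmap_comp.
crewrite (mu_nat T (f ⊗m idm Y)).
reflexivity.
Qed.

(** A unit carries no effect, so both orders of evaluation collapse to the same [tau T X Y]. *)
Lemma dst_tau_first_eta (X Y : C) :
  dst_tau_first T X Y ∘ (eta T X ⊗m idm (T Y)) = tau T X Y.
Proof.
unfold dst_tau_first.
crewrite (tau_natl Y (eta T X)).
crewrite (eq_sym (fmap_comp T (rtau T X Y) (eta T X ⊗m idm Y))).
rewrite rtau_eta.
crewrite (mu_fmap_eta T (X ⊗ Y)).
apply comp_idl.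
Qed.

Lemma dst_rtau_first_eta (X Y : C) :
  dst_rtau_first T X Y ∘ (eta T X ⊗m idm (T Y)) = tau T X Y.
Proof.
unfold dst_rtau_first.
crewrite (rtau_eta X (T Y)).
crewrite (eq_sym (eta_nat T (tau T X Y))).
crewrite (mu_eta T (X ⊗ Y)).
apply comp_idl.
Qed.

Lemma dst_tau_first_mu (X Y : C) :
  dst_tau_first T X Y ∘ (mu T X ⊗m idm (T Y))
  = mu T (X ⊗ Y) ∘ fmap T (rtau T X Y) ∘ dst_tau_first T (T X) Y.
Proof.
unfold dst_tau_first.
crewrite (tau_natl Y (mu T X)).
crewrite (eq_sym (fmap_comp T (rtau T X Y) (mu T X ⊗m idm Y))).
rewrite rtau_mu, !fmap_comp.
crewrite (eq_sym (mu_mu T (X ⊗ Y))).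
crewrite (mu_nat T (rtau T X Y)).
reflexivity.
Qed.

Lemma dst_rtau_first_mu (X Y : C) :
  dst_rtau_first T X Y ∘ (mu T X ⊗m idm (T Y))
  = mu T (X ⊗ Y) ∘ fmap T (dst_rtau_first T X Y) ∘ rtau T (T X) (T Y).
Proof.
unfold dst_rtau_first.
crewrite (rtau_mu X (T Y)).
crewrite (eq_sym (mu_nat T (tau T X Y))).
crewrite (mu_mu T (X ⊗ Y)).
now rewrite !fmap_comp, <- !comp_assoc.
Qed.

(** The intermediate order needed in [central_kleisli]: the outer layer of [T (T X)] acts first,
    then [T Y], then the inner layer. The two sides bracket this threefold composite differently, so
    [mu_nat] and [mu_mu] identify them. *)
Lemma rtau_dst_rtau_first (X Y : C) :
  mu T (X ⊗ Y) ∘ fmap T (rtau T X Y) ∘ dst_rtau_first T (T X) Y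
  = mu T (X ⊗ Y) ∘ fmap T (dst_tau_first T X Y) ∘ rtau T (T X) (T Y).
Proof.
unfold dst_rtau_first, dst_tau_first.
crewrite (eq_sym (mu_nat T (rtau T X Y))).
crewrite (mu_mu T (X ⊗ Y)).
now rewrite !fmap_comp, <- !comp_assoc.
Qed.

(** Here and in the next lemma, the strength on the first argument moves outside the double strength
    in the same way, so that a comparison of the two orders at [X ⊗ Y] reduces to one at [Y]. *)
Lemma dst_tau_first_tau (X Y W : C) :
  fmap T (assoc X Y W) ∘ dst_tau_first T (X ⊗ Y) W ∘ (tau T X Y ⊗m idm (T W))
  = tau T X (Y ⊗ W) ∘ (idm X ⊗m dst_tau_first T Y W) ∘ assoc X (T Y) (T W).
Proof.
unfold dst_tau_first; rewrite !tensm_compr.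
crewrite (tau_natl W (tau T X Y)).
crewrite (eq_sym (mu_nat T (assoc X Y W))).
crewrite (eq_sym (fmap_comp T (rtau T (X ⊗ Y) W) (tau T X Y ⊗m idm W))).
crewrite (eq_sym (fmap_comp T (fmap T (assoc X Y W))
                    (rtau T (X ⊗ Y) W ∘ (tau T X Y ⊗m idm W)))).
rewrite (comp_assoc (fmap T (assoc X Y W))), tau_rtau_assoc, !fmap_comp.
crewrite (tau_assoc T X (T Y) W).
crewrite (eq_sym (tau_nat T (idm X) (rtau T Y W))).
crewrite (eq_sym (tau_mu T X (Y ⊗ W))).
reflexivity.
Qed.

Lemma dst_rtau_first_tau (X Y W : C) :
  fmap T (assoc X Y W) ∘ dst_rtau_first T (X ⊗ Y) W ∘ (tau T X Y ⊗m idm (T W))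
  = tau T X (Y ⊗ W) ∘ (idm X ⊗m dst_rtau_first T Y W) ∘ assoc X (T Y) (T W).
Proof.
unfold dst_rtau_first; rewrite !tensm_compr.
crewrite (eq_sym (mu_nat T (assoc X Y W))).
crewrite (eq_sym (fmap_comp T (fmap T (assoc X Y W)) (tau T (X ⊗ Y) W))).
rewrite tau_assoc, !fmap_comp.
crewrite (tau_rtau_assoc X Y (T W)).
crewrite (eq_sym (tau_nat T (idm X) (tau T Y W))).
crewrite (eq_sym (tau_mu T X (Y ⊗ W))).
reflexivity.
Qed.

(** * Closure properties of central morphisms *)

Definition central (A X : C) (f : hom A (T X)) : Prop :=
  forall Y : C,
    dst_tau_first T X Y ∘ (f ⊗m idm (T Y))
    = dst_rtau_first T X Y ∘ (f ⊗m idm (T Y)).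

Lemma central_precomp (A B X : C) (f : hom A (T X)) (g : hom B A) :
  central f -> central (f ∘ g).
Proof. now intros Hf Y; rewrite tensm_compl, !comp_assoc, Hf. Qed.

Lemma central_fmap (A X X' : C) (f : hom A (T X)) (h : hom X X') :
  central f -> central (fmap T h ∘ f).
Proof.
intros Hf Y; rewrite tensm_compl.
crewrite (dst_tau_first_natl Y h).
crewrite (dst_rtau_first_natl Y h).
now rewrite Hf.
Qed.

Lemma central_eta (X : C) : central (eta T X).
Proof. now intros Y; rewrite dst_tau_first_eta, dst_rtau_first_eta. Qed.

Lemma central_kleisli (A B X : C) (f : hom A (T B)) (g : hom B (T X)) :
  central f -> central g -> central (mu T X ∘ fmap T g ∘ f).
Proof.
intros Hf Hg Y; rewrite !tensm_compl.
crewrite (dst_tau_first_mu X Y).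
crewrite (dst_rtau_first_mu X Y).
(* First exchange: centrality of [fmap T g ∘ f] moves [T Y] past the outer layer. *)
assert (Hgf := central_fmap g Hf Y); rewrite !tensm_compl in Hgf.
rewrite Hgf.
crewrite (rtau_dst_rtau_first X Y).
crewrite (rtau_nat g (idm (T Y))).
crewrite (eq_sym (fmap_comp T (dst_tau_first T X Y) (g ⊗m idm (T Y)))).
(* Second exchange, under [fmap T]: centrality of [g] moves [T Y] past the inner layer. *)
rewrite Hg, fmap_comp.
now rewrite <- !comp_assoc.
Qed.

Lemma central_tau (X B Y : C) (f : hom B (T Y)) :
  central f -> central (tau T X Y ∘ (idm X ⊗m f)).
Proof.
(* After the monic [fmap T (assoc X Y W)], the two sides differ only by the two sides of [Hf W]
   under [idm X ⊗m]. *)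
intros Hf W; apply fmap_assoc_mono; rewrite !tensm_compl.
crewrite (dst_tau_first_tau X Y W).
crewrite (dst_rtau_first_tau X Y W).
crewrite (assoc_nat (idm X) f (idm (T W))).
crewrite (eq_sym (tensm_compr X (dst_tau_first T Y W) (f ⊗m idm (T W)))).
crewrite (eq_sym (tensm_compr X (dst_rtau_first T Y W) (f ⊗m idm (T W)))).
now rewrite Hf.
Qed.

End Strength.

(** * Morphisms of strong monads with monic or central components *)

Section StrongMonadMorphism.

Variables (C : symmetric_monoidal_category) (S T : strong_monad C).
Variable i : strong_monad_morphism S T.

Lemma smm_rtau (X Y : C) :
  i (X ⊗ Y) ∘ rtau S X Y = rtau T X Y ∘ (i X ⊗m idm Y).
Proof.
unfold rtau.
crewrite (smm_nat i (braid Y X)).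
crewrite (smm_tau i Y X).
crewrite (braid_nat (i X) (idm Y)).
reflexivity.
Qed.

Lemma smm_dst_tau_first (X Y : C) :
  i (X ⊗ Y) ∘ dst_tau_first S X Y = dst_tau_first T X Y ∘ (i X ⊗m i Y).
Proof.
unfold dst_tau_first.
crewrite (smm_mu i (X ⊗ Y)).
crewrite (smm_nat i (rtau S X Y)).
crewrite (eq_sym (fmap_comp T (i (X ⊗ Y)) (rtau S X Y))).
rewrite smm_rtau, fmap_comp.
crewrite (smm_tau i (S X) Y).
crewrite (eq_sym (tau_natl T Y (i X))).
now rewrite <- tensm_comp, comp_idl, comp_idr.
Qed.

Lemma smm_dst_rtau_first (X Y : C) :
  i (X ⊗ Y) ∘ dst_rtau_first S X Y = dst_rtau_first T X Y ∘ (i X ⊗m i Y).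
Proof.
unfold dst_rtau_first.
crewrite (smm_mu i (X ⊗ Y)).
crewrite (smm_nat i (tau S X Y)).
crewrite (eq_sym (fmap_comp T (i (X ⊗ Y)) (tau S X Y))).
rewrite smm_tau, fmap_comp.
crewrite (smm_rtau X (S Y)).
crewrite (eq_sym (rtau_natr T X (i Y))).
now rewrite <- tensm_comp, comp_idl, comp_idr.
Qed.

Lemma smm_commutative :
  (forall X : C, monic (i X)) -> (forall X : C, central (i X)) -> commutative S.
Proof.
intros Hmono Hcentral X Y; apply Hmono.
rewrite smm_dst_tau_first, smm_dst_rtau_first.
(* Splits [i X ⊗m i Y] so that [i X ⊗m idm (T Y)] meets the double strengths, where centrality
   applies. *)
rewrite <- (comp_idr (i X)), <- (comp_idl (i Y)), tensm_comp, !comp_assoc.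
now rewrite Hcentral.
Qed.

(** A morphism of strong monads is determined by its components, so cancellation can be done
    objectwise. *)
Lemma smm_monic :
  (forall X : C, monic (i X)) -> monic (i : @hom (strong_monads C) S T).
Proof.
intros Hmono R f g E; apply strong_monad_morphism_eq; intros X; apply Hmono.
exact (f_equal (fun h : strong_monad_morphism R T => h X) E).
Qed.

End StrongMonadMorphism.

(** * The strong monad structure on the terminal central cones *)

Section TerminalCentralCones.

Variables (C : symmetric_monoidal_category) (T : strong_monad C).
Variable Z : forall X : C, central_cones T X.
Hypothesis hZ : forall X : C, terminal (Z X).

Lemma terminal_leg_monic (X : C) : monic (leg (Z X)).
Proof.
intros W f g E.
(* By [E], both [f] and [g] are cone morphisms to [Z X] from the single cone with leg
   [leg (Z X) ∘ f]. *)
pose (c := CentralCone (central_precomp f (leg_central (Z X)))).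
pose (mf := @ConeMorphism C T X c (Z X) f eq_refl).
pose (mg := @ConeMorphism C T X c (Z X) g (eq_sym E)).
destruct (@hZ X c) as [m [_ Hm]].
change (cone_map mf = cone_map mg).
now rewrite <- (Hm mf I), <- (Hm mg I).
Qed.

Lemma terminal_factor (A X : C) (f : hom A (T X)) :
  central f -> exists g : hom A (apex (Z X)), leg (Z X) ∘ g = f.
Proof.
intros Hf; destruct (hZ (CentralCone Hf)) as [m _].
exists (cone_map m); exact (cone_map_leg m).
Qed.

(** Terminality is a proposition, so extracting the factorisation as data takes indefinite
    description. Later arguments use it only through [leg_lift]. *)
Definition lift (A X : C) (f : hom A (T X)) (Hf : central f) :
    hom A (apex (Z X)) :=
  proj1_sig (constructive_indefinite_description _ (terminal_factor Hf)).

Lemma leg_lift (A X : C) (f : hom A (T X)) (Hf : central f) :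
  leg (Z X) ∘ lift Hf = f.
Proof.
exact (proj2_sig (constructive_indefinite_description _ (terminal_factor Hf))).
Qed.

Let legc (X : C) : central (leg (Z X)) := leg_central (Z X).

Definition centre_fmap (X Y : C) (f : hom X Y) :
    hom (apex (Z X)) (apex (Z Y)) :=
  lift (central_fmap f (@legc X)).

Definition centre_eta (X : C) : hom X (apex (Z X)) := lift (central_eta T X).

Definition centre_mu (X : C) : hom (apex (Z (apex (Z X)))) (apex (Z X)) :=
  lift (central_kleisli (@legc (apex (Z X))) (@legc X)).

Definition centre_tau (X Y : C) : hom (X ⊗ apex (Z Y)) (apex (Z (X ⊗ Y))) :=
  lift (central_tau X (@legc Y)).

Lemma leg_fmap (X Y : C) (f : hom X Y) :
  leg (Z Y) ∘ centre_fmap f = fmap T f ∘ leg (Z X).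
Proof. apply leg_lift. Qed.

Lemma leg_eta (X : C) : leg (Z X) ∘ centre_eta X = eta T X.
Proof. apply leg_lift. Qed.

Lemma leg_mu (X : C) :
  leg (Z X) ∘ centre_mu X
  = mu T X ∘ fmap T (leg (Z X)) ∘ leg (Z (apex (Z X))).
Proof. apply leg_lift. Qed.

Lemma leg_tau (X Y : C) :
  leg (Z (X ⊗ Y)) ∘ centre_tau X Y = tau T X Y ∘ (idm X ⊗m leg (Z Y)).
Proof. apply leg_lift. Qed.

Definition centre : strong_monad_on (fun X : C => apex (Z X)).
Proof.
(* Each law is checked after a monic leg: the [leg_] equations replace the operations by those of
   [T], and the matching law of [T] concludes. *)
refine (@StrongMonadOn C (fun X : C => apex (Z X))
          centre_fmap centre_eta centre_mu centre_tau
          _ _ _ _ _ _ _ _ _ _ _ _); intros; apply terminal_leg_monic.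
- now rewrite leg_fmap, fmap_id, comp_idl, comp_idr.
- crewrite (leg_fmap g).
  now rewrite !leg_fmap, fmap_comp, <- !comp_assoc.
- crewrite (leg_fmap f).
  crewrite (leg_eta Y).
  now rewrite leg_eta, eta_nat.
- crewrite (leg_mu Y).
  crewrite (leg_fmap f).
  crewrite (leg_fmap (centre_fmap f)).
  crewrite (leg_mu X).
  crewrite (eq_sym (fmap_comp T (leg (Z Y)) (centre_fmap f))).
  rewrite leg_fmap, fmap_comp.
  crewrite (mu_nat T f).
  reflexivity.
- crewrite (leg_tau X' Y').
  crewrite (leg_fmap (f ⊗m g)).
  crewrite (leg_tau X Y).
  crewrite (eq_sym (tau_nat T f g)).
  now rewrite <- !tensm_comp, leg_fmap, comp_idl, comp_idr.
- crewrite (leg_mu X).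
  crewrite (leg_eta (apex (Z X))).
  crewrite (eq_sym (eta_nat T (leg (Z X)))).
  crewrite (mu_eta T X).
  now rewrite comp_idl, comp_idr.
- crewrite (leg_mu X).
  crewrite (leg_fmap (centre_eta X)).
  crewrite (eq_sym (fmap_comp T (leg (Z X)) (centre_eta X))).
  rewrite leg_eta.
  crewrite (mu_fmap_eta T X).
  now rewrite comp_idl, comp_idr.
- crewrite (leg_mu X).
  crewrite (leg_mu (apex (Z X))).
  crewrite (eq_sym (mu_nat T (leg (Z X)))).
  crewrite (leg_mu X).
  crewrite (leg_fmap (centre_mu X)).
  crewrite (eq_sym (fmap_comp T (leg (Z X)) (centre_mu X))).
  rewrite leg_mu, !fmap_comp.
  crewrite (mu_mu T X).
  reflexivity.
- crewrite (leg_fmap (lunit X)).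
  crewrite (leg_tau unit X).
  crewrite (tau_lunit T X).
  apply lunit_nat.
- crewrite (leg_fmap (assoc X Y Z0)).
  crewrite (leg_tau (X ⊗ Y) Z0).
  crewrite (tau_assoc T X Y Z0).
  crewrite (leg_tau X (Y ⊗ Z0)).
  crewrite (eq_sym (tensm_compr X (leg (Z (Y ⊗ Z0))) (centre_tau Y Z0))).
  rewrite leg_tau, tensm_compr, <- tensm_id.
  crewrite (assoc_nat (idm X) (idm Y) (leg (Z Z0))).
  reflexivity.
- crewrite (leg_tau X Y).
  rewrite <- tensm_compr, !leg_eta.
  apply tau_eta.
- crewrite (leg_tau X Y).
  rewrite <- tensm_compr, leg_mu, !tensm_compr.
  crewrite (tau_mu T X Y).
  crewrite (leg_mu (X ⊗ Y)).
  crewrite (leg_fmap (centre_tau X Y)).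
  crewrite (leg_tau X (apex (Z Y))).
  crewrite (eq_sym (fmap_comp T (leg (Z (X ⊗ Y))) (centre_tau X Y))).
  rewrite leg_tau, fmap_comp.
  crewrite (tau_nat T (idm X) (leg (Z Y))).
  reflexivity.
Defined.

(** The defining equations of the four lifted operations are exactly the conditions for the legs to
    form a morphism of strong monads. *)
Definition centre_inclusion : strong_monad_morphism (StrongMonad centre) T :=
  @StrongMonadMorphism C (StrongMonad centre) T
    (fun X : C => leg (Z X)) leg_fmap leg_eta leg_mu leg_tau.

End TerminalCentralCones.

(** * The centre as a commutative submonad *)

Theorem theorem2p6 (C : symmetric_monoidal_category) (T : strong_monad C)
    (hT : centralisable T)
    (Z : forall X : C, central_cones T X)
    (hZ : forall X : C, terminal (Z X)) :
  exists (S : strong_monad_on (fun X : C => apex (Z X)))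
         (i : strong_monad_morphism (StrongMonad S) T),
    (forall X : C, i X = leg (Z X)) /\
    is_commutative_submonad (i : @hom (strong_monads C) (StrongMonad S) T).
Proof.
exists (centre hZ), (centre_inclusion hZ).
split; [reflexivity|split].
- apply (smm_commutative (i := centre_inclusion hZ)).
  + exact (terminal_leg_monic hZ).
  + exact (fun X => leg_central (Z X)).
- exact (smm_monic (i := centre_inclusion hZ) (terminal_leg_monic hZ)).
Qed.
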